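(* Let $r\ge 3$. For every sufficiently large $n$ there exists an $r$-uniform $r$-partite linear hypergraph $\mathcal{H}$ on $n$ vertices with $|\mathcal{H}|>n^{2-o(1)}$ edges (the $o(1)$ term tending to $0$ as $n\to\infty$) which contains no rainbow cycles of length three or four.
   Context: A hypergraph is linear if any two distinct edges share at most one vertex. An $r$-uniform hypergraph is $r$-partite if its vertex set is partitioned into $r$ parts $V_1,\dots,V_r$ such that every edge contains exactly one vertex of each part. A cycle of length $k$ in a hypergraph is a sequence $v_1,A_1,v_2,A_2,\dots,v_k,A_k,v_1$ where $v_1,\dots,v_k$ are distinct vertices, $A_1,\dots,A_k$ are distinct edges, $v_i,v_{i+1}\in A_i$ for $1\le i\le k-1$ and $v_k,v_1\in A_k$. In an $r$-uniform $r$-partite linear hypergraph such a cycle is a rainbow $k$-cycle if $v_1,\dots,v_k$ lie in $k$ pairwise different parts. *)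

(* Defs.v *)
From mathcomp Require Import all_boot.

Set Implicit Arguments.
Unset Strict Implicit.
Unset Printing Implicit Defensive.

Section Hypergraph.
Variable T : finType.

(* A hypergraph on the vertex set T is given by its set E of edges. *)
Implicit Type E : {set {set T}}.

Definition uniform (r : nat) E : Prop := forall A, A \in E -> #|A| = r.

Definition linear_hypergraph E : Prop :=
  forall A B, A \in E -> B \in E -> A != B -> #|A :&: B| <= 1.

(* The partition V_1, ..., V_r is encoded by the map part sending each vertex
   to the index of its part; a part is nonempty as soon as E is. *)
Definition partite (r : nat) (part : T -> 'I_r) E : Prop :=
  forall A, A \in E -> forall i : 'I_r, #|[set x in A | part x == i]| = 1.

(* v_1, A_1, ..., v_k, A_k, v_1, with indices in 'I_k; ordS is the cyclic
   successor, so that the last edge contains v_k and v_1. *)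
Definition is_cycle E (k : nat) (v : 'I_k -> T) (A : 'I_k -> {set T}) : Prop :=
  [/\ injective v, injective A, forall i, A i \in E
    & forall i, v i \in A i /\ v (ordS i) \in A i].

Definition rainbow_cycle (r : nat) (part : T -> 'I_r) E (k : nat)
    (v : 'I_k -> T) (A : 'I_k -> {set T}) : Prop :=
  is_cycle E v A /\ injective (fun i => part (v i)).

Definition has_rainbow_cycle (r : nat) (part : T -> 'I_r) E (k : nat) : Prop :=
  exists (v : 'I_k -> T) (A : 'I_k -> {set T}), rainbow_cycle part E v A.

End Hypergraph.

(* Main.v *)
(** Take vertices (i, y) with i < r and y a vector of k polynomials over Z/B of
bounded degree, and edges {(i, x + a_i d) : i < r} for suitable a_i in Z[X] and
labels d, vectors of polynomials whose coefficients lie in [0, b), where B is a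
large constant multiple of b. A cycle through vertices in parts p_0, p_1, ...
and edges with labels d_0, d_1, ... gives the relation
sum_u (a_(p_(u+1)) - a_(p_u)) d_u = 0, which holds exactly in Z[X] since its
coefficients are smaller than B.

As in Behrend's construction the labels lie on a sphere sum_h d_h^2 = q, here
with q in Z[X]. The a_i are such that every linear order of the parts is the
order of the integers a_i(t) for some integer t. Given a rainbow cycle, choose t
so that the a_(p_u)(t) increase with u; then the coefficients of the relation,
except the last one, are positive at t, and the relation is a convex one "at t".
Expanding squares, sum_u c_u |d_u - d_last|^2 = 0, which forces all labels to be
equal: evaluate at t and divide by X - t as long as possible. Thus there are no
rainbow cycles at all, of any length, and the case of length 2 is linearity.

The pigeonhole principle gives a large sphere: only about 2m coefficients of q
are fixed out of the km coefficients of d. *)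

Require Import Defs.
From mathcomp Require Import all_boot all_order all_algebra.
From mathcomp Require Import all_classical all_reals all_analysis.
From mathcomp Require Import zify ring.
Import Order.TTheory GRing.Theory Num.Theory.
Import numFieldNormedType.Exports.

Set Implicit Arguments.
Unset Strict Implicit.
Unset Printing Implicit Defensive.

Local Open Scope ring_scope.

(** * Weighted sums of squares and convex relations in Z[X] *)

Lemma weighted_sum_squares_eq0 (I : finType) (t : int) (w f : I -> {poly int}) :
  (forall i, 0 < (w i).[t]) -> \sum_i w i * f i ^+ 2 = 0 -> forall i, f i = 0.
Proof.
move=> w_gt0.
have [N] : exists N, forall i, (size (f i) <= N)%N.
  by exists (\max_i size (f i))%N => i; apply: leq_bigmax.
elim: N f => [|N IHN] f szf sum0 i; first by apply/eqP; rewrite -size_poly_leq0.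
have rootf j : root (f j) t.
  have sum0t : \sum_u (w u).[t] * (f u).[t] ^+ 2 = 0.
    rewrite -[RHS](horner0 t) -sum0 horner_sum.
    by apply: eq_bigr => u _; rewrite hornerM horner_exp.
  have terms_ge0 u : true -> 0 <= (w u).[t] * (f u).[t] ^+ 2.
    by move=> _; rewrite mulr_ge0 ?sqr_ge0 // ltW.
  have /eqP := psumr_eq0P terms_ge0 sum0t (i := j) isT.
  by rewrite mulf_eq0 gt_eqF //= expf_eq0.
have [g fE] := fin_all_exists (fun j => factor_theorem _ _ (rootf j)).
suff g0 : forall j, g j = 0 by rewrite fE g0 mul0r.
apply: IHN => [j|].
  have [->|gj0] := eqVneq (g j) 0; first by rewrite size_poly0.
  by have := szf j; rewrite fE size_Mmonic ?monicXsubC // size_XsubC addnC.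
have : (\sum_j w j * g j ^+ 2) * ('X - t%:P) ^+ 2 = 0.
  by rewrite -[RHS]sum0 mulr_suml; apply: eq_bigr => j _; rewrite fE exprMn -[LHS]mulrA.
by move/eqP; rewrite mulf_eq0 expf_eq0 polyXsubC_eq0 orbF => /eqP.
Qed.

Lemma exists_polys_realizing_orders (r : nat) :
  exists a : 'I_r -> {poly int}, forall phi : 'I_r -> 'I_r, exists t : int,
    forall i j, (phi i < phi j)%N -> (a i).[t] < (a j).[t].
Proof.
(* Interpolation without denominators: the a_i are combinations of the squares
   of e phi, which vanishes at every point pt psi except pt phi. *)
pose pt (phi : {ffun 'I_r -> 'I_r}) : int := (enum_rank phi : nat)%:Z.
have pt_inj : injective pt by move=> x y [] /val_inj/enum_rank_inj.
pose e phi : {poly int} := \prod_(psi | psi != phi) ('X - (pt psi)%:P).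
have e_eq0 phi psi : psi != phi -> (e phi).[pt psi] = 0.
  by move=> ne; rewrite /e (bigD1 psi) //= hornerM hornerXsubC subrr mul0r.
have e_neq0 phi : (e phi).[pt phi] != 0.
  rewrite horner_prod prodf_seq_neq0; apply/allP => psi _; apply/implyP => ne.
  by rewrite hornerXsubC subr_eq0 inj_eq // eq_sym.
exists (fun i => \sum_phi (e phi ^+ 2) * ((phi i : nat)%:Z)%:P) => phi0.
pose phi := finfun phi0; exists (pt phi) => i j lt_ij.
have aE u : (\sum_psi (e psi ^+ 2) * ((psi u : nat)%:Z)%:P).[pt phi]
    = (e phi).[pt phi] ^+ 2 * (phi0 u : nat)%:Z.
  rewrite horner_sum (bigD1 phi) //= big1 => [|psi ne].
    by rewrite addr0 hornerM horner_exp hornerC ffunE.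
  by rewrite hornerM horner_exp e_eq0 ?expr0n ?mul0r // eq_sym.
rewrite !aE ltr_pM2l ?ltz_nat // lt_neqAle sqr_ge0 andbT eq_sym expf_eq0 /=.
exact: e_neq0.
Qed.

Lemma convex_relation_const (K k : nat) (l : 'I_K) (t : int)
    (c : 'I_K -> {poly int}) (d : 'I_K -> 'I_k -> {poly int}) (q : {poly int}) :
    (forall u, u != l -> 0 < (c u).[t]) -> \sum_u c u = 0 ->
    (forall h, \sum_u c u * d u h = 0) ->
    (forall u, \sum_h d u h ^+ 2 = q) ->
  forall u, d u =1 d l.
Proof.
move=> c_gt0 sumc sumcd dq.
(* The l-th difference vanishes, so its weight may be replaced by 1. *)
pose w (uh : 'I_K * 'I_k) : {poly int} := if uh.1 == l then 1 else c uh.1.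
pose f (uh : 'I_K * 'I_k) := d uh.1 uh.2 - d l uh.2.
suff f0 : forall uh, f uh = 0.
  by move=> u h; apply/eqP; rewrite -subr_eq0; apply/eqP/(f0 (u, h)).
apply: (@weighted_sum_squares_eq0 _ t w) => [[u h]|].
  by rewrite /w /=; case: eqP => [_|/eqP]; [rewrite hornerC | apply: c_gt0].
transitivity (\sum_u \sum_h c u * (d u h - d l h) ^+ 2).
  rewrite pair_big; apply: eq_bigr => -[u h] _; rewrite /w /f /=.
  by case: eqP => [->|//]; rewrite subrr expr0n !mulr0.
(* Both squared norms equal [q]; after summation over [u], [sumc] kills the part with [q + q] and
   [sumcd] the inner products. *)
transitivity (\sum_u (c u * (q + q) - \sum_h c u * d u h * (d l h *+ 2))).
  apply: eq_bigr => u _.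
  rewrite -{1}(dq u) -(dq l) -big_split /= mulr_sumr -sumrB.
  by apply: eq_bigr => h _; ring.
rewrite sumrB -mulr_suml sumc mul0r sub0r exchange_big /= big1 ?oppr0 // => h _.
by rewrite -mulr_suml sumcd mul0r.
Qed.

(** * Coefficient bounds and reduction modulo [B] *)

Definition l1norm (p : {poly int}) : nat := (\sum_(i < size p) `|(p`_i)%R|)%N.

Lemma coef_mul_l1norm (p q : {poly int}) (b : nat) :
  (forall j, (`|(q`_j)%R| <= b)%N) -> forall j, (`|((p * q)`_j)%R| <= l1norm p * b)%N.
Proof.
move=> q_le j; rewrite -lez_nat abszE -[p in p * q]coefK poly_def mulr_suml coef_sum.
apply: (le_trans (ler_norm_sum _ _ _)).
rewrite /l1norm big_distrl /=.
rewrite (big_morph Posz PoszD (erefl 0%:Z)).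
apply: ler_sum => i _; rewrite -scalerAl coefZ normrM PoszM abszE.
rewrite ler_wpM2l // coefXnM; case: ifP => _; first by rewrite normr0.
by rewrite -abszE lez_nat.
Qed.

Lemma intr_Zp_eq0 (B : nat) (z : int) :
  (`|z| < B)%N -> z%:~R = 0 :> 'Z_B -> z = 0.
Proof.
(* For [B <= 1] the ring ['Z_B] is not Z/B, but the bound alone forces [z = 0]. *)
have [|B_gt1 ltzB] := leqP B 1%N.
  by case: B => [|[|//]] _ //; rewrite ltnS leqn0 absz_eq0 => /eqP.
have nat_eq0 (n : nat) : (n < B)%N -> n%:R = 0 :> 'Z_B -> n = 0%N.
  by move=> ltnB /(congr1 val) /=; rewrite val_Zp_nat // modn_small.
move=> zB0; apply/eqP; rewrite -absz_eq0; apply/eqP/nat_eq0 => //.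
case: (intP z) zB0 => [//|n|n]; rewrite ?abszN !absz_nat //.
by rewrite rmorphN /= => /eqP; rewrite oppr_eq0 => /eqP.
Qed.

(** * The hypergraph and its cycles *)

Section Construction.

Variables (r k m M b B L : nat) (a : 'I_r -> {poly int}).
Variable S : {set 'M['I_b]_(k, m)}.
Hypothesis a_orders : forall phi : 'I_r -> 'I_r, exists t : int,
    forall i j, (phi i < phi j)%N -> (a i).[t] < (a j).[t].
(** With [M] columns, no coefficient of a product [a i * polys_of d h] is cut off. *)
Hypothesis size_a : forall i, (size (a i) + m <= M)%N.
Hypothesis norm_a : forall i, (l1norm (a i) <= L)%N.
(** A rainbow cycle has at most [r] edges, each adding at most [2 * L * b] to a coefficient of the
    relation, so nothing wraps around modulo [B]. *)
Hypothesis ltB : (r * (2 * (L * b)) < B)%N.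

Definition polys_of (d : 'M['I_b]_(k, m)) (h : 'I_k) : {poly int} :=
  rVpoly (row h (map_mx (fun z : 'I_b => (z : nat)%:Z) d)).

Hypothesis sphereS : {in S &, forall d d',
  \sum_h polys_of d h ^+ 2 = \sum_h polys_of d' h ^+ 2}.

Lemma polys_of_inj d d' : polys_of d =1 polys_of d' -> d = d'.
Proof.
move=> eqd; apply/matrixP => h j; apply: val_inj => /=.
have := congr1 (fun p : {poly int} => p`_j) (eqd h).
by rewrite !coef_rVpoly_ord !mxE => -[].
Qed.

Lemma coef_polys_of d h j :
  exists2 z : nat, (polys_of d h)`_j = z%:Z & (z < b)%N || (z == 0)%N.
Proof.
rewrite coef_rVpoly; case: insubP => [i _ _|_]; last by exists 0%N; rewrite ?orbT.
by exists (d h i : nat); rewrite ?mxE ?ltn_ord.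
Qed.

(* Coefficients are reduced modulo B; 'Z_B is Z/B only for B > 1. *)
Definition label_shift (i : 'I_r) (d : 'M['I_b]_(k, m)) : 'M['Z_B]_(k, M) :=
  \matrix_(h, j) ((a i * polys_of d h)`_j)%:~R.

Lemma coef_shift_le i d h j : (`|((a i * polys_of d h)`_j)%R| <= L * b)%N.
Proof.
apply: (@leq_trans (l1norm (a i) * b)); last by rewrite leq_mul2r norm_a orbT.
apply: coef_mul_l1norm => j'; have [z -> /orP[/ltnW//|/eqP->]] := coef_polys_of d h j'.
by [].
Qed.

(** Here [closed] says that edges [u] and [ordS u] meet in part [p (ordS u)]. The edges need not be
    distinct, so the lemma also serves to count them. *)
Lemma cycle_labels_eq (K : nat) (p : 'I_K.+1 -> 'I_r)
    (x : 'I_K.+1 -> 'M['Z_B]_(k, M)) (d : 'I_K.+1 -> 'M['I_b]_(k, m)) :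
    injective p -> (forall u, d u \in S) ->
    (forall u, x u + label_shift (p (ordS u)) (d u)
             = x (ordS u) + label_shift (p (ordS u)) (d (ordS u))) ->
  forall u, d u = d ord_max.
Proof.
move=> p_inj dS closed u; apply: polys_of_inj.
have leKr : (K.+1 <= r)%N by have := leq_card p p_inj; rewrite !card_ord.
(* An order of the parts along which the cycle is increasing. *)
pose phi i := odflt (p ord0) (omap (widen_ord leKr) [pick u | p u == i]).
have phi_p u' : phi (p u') = u' :> nat.
  rewrite /phi; case: pickP => [v /eqP/p_inj->//|/(_ u')]; by rewrite eqxx.
have [t a_t] := a_orders phi.
pose c u := a (p (ordS u)) - a (p u).
have sum_cycl (V : zmodType) (F : 'I_K.+1 -> V) : \sum_u (F (ordS u) - F u) = 0.
  rewrite sumrB [X in X - _](_ : _ = \sum_u F u) ?subrr //.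
  by rewrite [RHS](reindex_inj (@ordS_inj _)).
apply: (@convex_relation_const _ _ ord_max t c (fun u => polys_of (d u))
  (\sum_h polys_of (d ord_max) h ^+ 2)) => [v v_max||h|v]; last by apply: sphereS.
(* Away from [ord_max] the cyclic successor does not wrap around, so [phi] increases along the
   step. *)
- rewrite hornerD hornerN subr_gt0; apply: a_t; rewrite !phi_p /= modn_small //.
  by rewrite ltnS ltn_neqAle -ltnS ltn_ord andbT -[K]/(nat_of_ord (@ord_max K)) val_eqE.
- exact: sum_cycl.
apply/polyP => j; rewrite coef0.
have [leMj|ltjM] := leqP M j.
  rewrite nth_default //; apply: (leq_trans (size_sum _ _ _)).
  apply/bigmax_leqP => v _; rewrite (leq_trans _ leMj) //.
  have sz i : (size (a i * polys_of (d v) h)%R <= M)%N.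
    apply: leq_trans (size_a i); apply: (leq_trans (size_polyMleq _ _)).
    by rewrite (leq_trans (leq_pred _)) // leq_add2l size_poly.
  by rewrite /c mulrBl (leq_trans (size_polyD _ _)) // size_polyN geq_max !sz.
apply: (@intr_Zp_eq0 B).
  apply: leq_ltn_trans ltB; apply: (@leq_trans (K.+1 * (2 * (L * b)))); last first.
    by rewrite leq_mul2r leKr orbT.
  rewrite -lez_nat abszE coef_sum (le_trans (ler_norm_sum _ _ _)) //.
  apply: (@le_trans _ _ (\sum_(v < K.+1) (2 * (L * b))%:Z)); last first.
    by rewrite sumr_const card_ord -mulr_natl natz PoszM.
  apply: ler_sum => v _; rewrite /c mulrBl coefB (le_trans (ler_normB _ _)) //.
  by rewrite mul2n -addnn PoszD lerD // -abszE lez_nat coef_shift_le.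
(* Telescoping the vertices of edge [v] in part [p v]: by [closed] the base points cancel in each
   difference, leaving [c v] times the label. *)
have := sum_cycl _ (fun v => x v + label_shift (p v) (d v)).
move=> /matrixP/(_ h (Ordinal ltjM)).
rewrite coef_sum rmorph_sum /= mxE summxE => sum0.
rewrite -[RHS]sum0; apply: eq_bigr => v _.
rewrite -closed opprD addrACA subrr add0r !mxE /c mulrBl coefB rmorphB //.
Qed.

(** Agreement in the first two parts is already a closed walk of length 2, so the labels coincide,
    and then the base points do. *)
Lemma shift_system_inj (x x' : 'M['Z_B]_(k, M)) d d' : (1 < r)%N ->
    d \in S -> d' \in S -> (forall i, x + label_shift i d = x' + label_shift i d') ->
  x = x' /\ d = d'.
Proof.
move=> r_gt1 dS d'S eq_xd.
pose p := widen_ord r_gt1.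
pose sel T (y y' : T) (u : 'I_2) := if u == ord0 then y else y'.
have eqd : d = d'.
  apply: (@cycle_labels_eq 1 p (sel _ x x') (sel _ d d') _ _ _ ord0).
  - by move=> u v [] /val_inj.
  - by move=> u; rewrite /sel; case: ifP.
  - move=> u; rewrite /sel; have [->|u0] := eqVneq u ord0; first exact: eq_xd.
    suff -> : ordS u = ord0 by rewrite eqxx -eq_xd.
    by case: u u0 => [[|[|//]]] // *; apply: val_inj.
by split=> //; have := eq_xd (p ord0); rewrite eqd => /addIr.
Qed.

Definition edge (xd : 'M['Z_B]_(k, M) * 'M['I_b]_(k, m)) :
    {set 'I_r * 'M['Z_B]_(k, M)} := [set (i, xd.1 + label_shift i xd.2) | i : 'I_r].

Definition edges := [set edge xd | xd in finset.setX finset.setT S].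

Lemma in_edge v xd : (v \in edge xd) = (v.2 == xd.1 + label_shift v.1 xd.2).
Proof.
apply/imsetP/eqP => [[i _ ->] //|]; case: v => i y /= ->; by exists i.
Qed.

Lemma partite_edges : partite fst edges.
Proof.
move=> _ /imsetP[xd _ ->] i; apply/eqP/cards1P.
exists (i, xd.1 + label_shift i xd.2); apply/setP => -[j y]; rewrite !inE in_edge /=.
by rewrite xpair_eqE andbC; have [->|] := eqVneq j i.
Qed.

Lemma card_edges : (1 < r)%N -> (1 < B)%N -> #|edges| = (B ^ (k * M) * #|S|)%N.
Proof.
move=> r_gt1 B_gt1; rewrite card_in_imset.
  by rewrite cardsX cardsT card_mx card_ord Zp_cast.
move=> [x d] [x' d']; rewrite !inE /= => dS d'S /setP eqe.
have [i|-> ->//] := shift_system_inj r_gt1 dS d'S (x := x) (x' := x').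
by have := eqe (i, x + label_shift i d); rewrite !in_edge /= eqxx => /esym/eqP.
Qed.

Lemma edges_no_rainbow_cycle K : ~ has_rainbow_cycle fst edges K.+2.
Proof.
case=> v [A [[_ A_inj AE vA] p_inj]].
have {AE} [xd AE] : exists xd : 'I_K.+2 -> _,
    forall u, A u = edge (xd u) /\ (xd u).2 \in S.
  apply: (@fin_all_exists _ _ (fun u z => A u = edge z /\ z.2 \in S)) => u.
  by have /imsetP[z zS ->] := AE u; exists z; move: zS; rewrite !inE.
have vE u w : v u \in A w -> (v u).2 = (xd w).1 + label_shift (v u).1 (xd w).2.
  by rewrite (AE w).1 in_edge => /eqP.
have eqd := @cycle_labels_eq K.+1 (fun u => (v u).1) (fun u => (xd u).1)
  (fun u => (xd u).2) p_inj (fun u => (AE u).2).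
have {}eqd : forall u, (xd u).2 = (xd ord_max).2.
  by apply: eqd => u; rewrite -!vE //; case: (vA u) (vA (ordS u)) => ? ? [].
(* The first and last edges share the vertex [v ord0] and the label, hence the base point, although
   their indices differ. *)
suff /A_inj : A ord0 = A ord_max by move/(congr1 val).
rewrite !(AE _).1; congr edge.
have o0 : ordS (@ord_max K.+1) = ord0 by apply: val_inj; rewrite /= modnn.
have := vE _ _ (vA ord0).1; have := vE _ _ (vA ord_max).2.
rewrite o0 (eqd ord0) => -> /addIr.
by case: (xd ord0) (xd ord_max) (eqd ord0) => [? ?] [? ?] /= -> ->.
Qed.

End Construction.

(** * Large spheres by pigeonhole *)

Lemma exists_large_fiber (T V : finType) (g : T -> V) (v0 : V) :
  exists v, (#|T| <= #|V| * #|[set x | g x == v]|)%N.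
Proof.
pose F v := #|[set x | g x == v]|.
exists [arg max_(v > v0) F v]; case: arg_maxnP => // v _ F_max.
rewrite -sum_nat_const -[X in (X <= _)%N]sum1_card (partition_big g predT) //=.
apply: leq_sum => u _; rewrite (leq_trans _ (F_max u isT)) //.
by rewrite /F -sum1_card; apply/eq_leq/eq_bigl => x; rewrite inE.
Qed.

Lemma exists_large_sphere (k m b : nat) :
  exists S : {set 'M['I_b]_(k, m)},
    {in S &, forall d d',
      \sum_h polys_of d h ^+ 2 = \sum_h polys_of d' h ^+ 2} /\
    (b ^ (k * m) <= (k * (m * b * b)).+1 ^ (2 * m) * #|S|)%N.
Proof.
pose V := {ffun 'I_(2 * m) -> 'I_(k * (m * b * b)).+1}.
pose q (d : 'M['I_b]_(k, m)) := \sum_h polys_of d h ^+ 2.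
(* Neither the absolute value nor [inord] loses information, by [q_ge0] and [q_le] below. *)
pose g d : V := [ffun j : 'I_(2 * m) => inord `|((q d)`_j)%R|%N].
have [v] := exists_large_fiber g [ffun=> ord0].
rewrite card_mx !card_ord card_ffun !card_ord => cardS.
exists [set d | g d == v]; split => // d d'; rewrite !inE => /eqP gd /eqP gd'.
have q_ge0 d0 j : 0 <= (q d0)`_j.
  rewrite coef_sum sumr_ge0 // => h _; rewrite coefM sumr_ge0 // => i _.
  have [[z -> _] [z' -> _]] := (coef_polys_of d0 h i, coef_polys_of d0 h (j - i)%N).
  by rewrite -PoszM lez_nat.
have coef_le (d0 : 'M['I_b]_(k, m)) h j : (`|((polys_of d0 h)`_j)%R| <= b)%N.
  have [z -> /orP[ltzb|/eqP->]] := coef_polys_of d0 h j; last by rewrite absz0.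
  by rewrite absz_nat ltnW.
have q_le d0 j : (`|((q d0)`_j)%R| <= k * (m * b * b))%N.
  rewrite -lez_nat abszE coef_sum (le_trans (ler_norm_sum _ _ _)) //.
  rewrite -[k in (k * _)%N]card_ord PoszM -natz mulr_natl -sumr_const.
  apply: ler_sum => h _; rewrite -abszE lez_nat expr2.
  apply: (leq_trans (coef_mul_l1norm _ (coef_le d0 h) j)); rewrite leq_mul2r.
  apply/orP; right; apply: (@leq_trans (size (polys_of d0 h) * b)).
    rewrite -[size _ in X in (_ <= X)%N]card_ord -sum_nat_const.
    by apply: leq_sum => i _; apply: coef_le.
  by rewrite leq_mul2r size_poly orbT.
apply/polyP => j; have [le2mj|ltj2m] := leqP (2 * m) j.
  suff sz d0 : (size (q d0) <= 2 * m)%N by rewrite !nth_default // (leq_trans (sz _)).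
  apply: (leq_trans (size_sum _ _ _)); apply/bigmax_leqP => h _.
  rewrite (leq_trans (size_polyMleq _ _)) // (leq_trans (leq_pred _)) //.
  by rewrite mul2n -addnn leq_add // size_poly.
have /ffunP/(_ (Ordinal ltj2m)) := etrans gd (esym gd').
rewrite !ffunE => /(congr1 val) /=; rewrite !inordK ?ltnS //= => eq_abs.
by rewrite -(gez0_abs (q_ge0 d j)) -(gez0_abs (q_ge0 d' j)) eq_abs.
Qed.

(** * General facts on partite hypergraphs *)

Lemma partite_uniform (T : finType) (r : nat) (part : T -> 'I_r)
  (E : {set {set T}}) : partite part E -> uniform r E.
Proof.
move=> part_E A AE; rewrite -sum1_card (partition_big part predT) //=.
transitivity (\sum_(i < r) 1)%N; last by rewrite sum1_card card_ord.
apply: eq_bigr => i _; rewrite -[RHS](part_E A AE i) -[RHS]sum1_card.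
by apply: eq_bigl => x; rewrite [RHS]inE.
Qed.

(** Two common vertices of [A] and [B] lie in different parts, since [A] meets each part once, so
    they give a rainbow 2-cycle. *)
Lemma partite_linear (T : finType) (r : nat) (part : T -> 'I_r)
    (E : {set {set T}}) :
  partite part E -> ~ has_rainbow_cycle part E 2 -> linear_hypergraph E.
Proof.
move=> part_E no2 A B AE BE neAB; rewrite leqNgt; apply/negP => /card_gt1P.
case=> [x [y [/setIP[xA xB] /setIP[yA yB] nexy]]]; apply: no2.
have part_ne : part x != part y.
  apply: contra nexy => /eqP eq_part.
  have /eqP/cards1P[z /setP zE] := part_E A AE (part y).
  have := zE x; have := zE y; rewrite !inE xA yA eq_part eqxx /=.
  by move=> /esym/eqP-> /esym ->.
pose sel (U : Type) (u u' : U) (i : 'I_2) := if i == ord0 then u else u'.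
have sel_inj (U : eqType) (u u' : U) : u != u' -> injective (sel U u u').
  move=> ne i j; rewrite /sel; have [->|i0] := eqVneq i ord0;
    have [->|j0] := eqVneq j ord0 => //.
  - by move/eqP; rewrite (negPf ne).
  - by move/eqP; rewrite eq_sym (negPf ne).
  by move=> _; case: i j i0 j0 => [[|[|//]] ?] [[|[|//]] ?] // _ _; apply: val_inj.
exists (sel T x y), (sel _ A B); split; last first.
  have part_sel i : part (sel _ x y i) = sel _ (part x) (part y) i.
    by rewrite /sel; case: ifP.
  by move=> i j /=; rewrite !part_sel; apply: sel_inj.
split=> [||i|i]; [exact: (@sel_inj T x y nexy)
  |exact: (@sel_inj _ A B neAB)|by rewrite /sel; case: ifP|].
by rewrite /sel; split; case: (i == ord0); case: (ordS i == ord0).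
Qed.

(** Enlarges the vertex set to a prescribed size: vertices outside the image of [f] lie in no edge,
    so the default part [i0] suits them. *)
Lemma rainbow_free_transport (T U : finType) (r : nat) (part : T -> 'I_r)
    (E : {set {set T}}) (f : T -> U) (i0 : 'I_r) :
    injective f -> partite part E ->
  exists (part' : U -> 'I_r) (E' : {set {set U}}),
    [/\ partite part' E', #|E'| = #|E| & forall K,
        ~ has_rainbow_cycle part E K -> ~ has_rainbow_cycle part' E' K].
Proof.
move=> f_inj part_E.
pose part' u := odflt i0 (omap part [pick x | f x == u]).
have part'f x : part' (f x) = part x.
  by rewrite /part'; case: pickP => [y /eqP/f_inj->|/(_ x)] //; rewrite eqxx.
have imf_inj : injective (fun A : {set T} => f @: A) by apply: imset_inj.
exists part', [set f @: A | A : {set T} in E]; split.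
- move=> _ /imsetP[A AE ->] i; rewrite -(part_E A AE i) -(card_imset _ f_inj).
  apply: eq_card => u; apply/idP/idP.
    rewrite inE => /andP[/imsetP[x xA ->]]; rewrite part'f => xi.
    by rewrite imset_f // inE xA.
  by case/imsetP => x; rewrite inE => /andP[xA xi] ->; rewrite inE part'f xi imset_f.
- by rewrite card_imset.
move=> K noK [v [A [[v_inj A_inj AE vA] p_inj]]]; apply: noK.
have [A0 A0E] : exists A0 : 'I_K -> {set T}, forall u, A u = f @: A0 u /\ A0 u \in E.
  apply: (@fin_all_exists _ (fun=> {set T}) (fun u B => A u = f @: B /\ B \in E)) => u.
  by have /imsetP[B BE ->] := AE u; exists B.
have [v0 v0E] : exists v0 : 'I_K -> T, forall u, v u = f (v0 u).
  apply: (@fin_all_exists _ (fun=> T) (fun u x => v u = f x)) => u; have [+ _] := vA u.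
  by rewrite (A0E u).1 => /imsetP[x _ ->]; exists x.
exists v0, A0; split; last first.
  by move=> i j; rewrite -!part'f -!v0E => /p_inj.
split=> [i j eqv|i j eqA|i|i].
- by apply: v_inj; rewrite !v0E eqv.
- by apply: A_inj; rewrite (A0E i).1 (A0E j).1 eqA.
- exact: (A0E i).2.
by have := vA i; rewrite !v0E (A0E i).1 !mem_imset.
Qed.

(** * Choice of parameters and edge count *)

(** The construction has [r * B ^ P] vertices; the upper bound shows that padding to [n] costs only
    a constant factor. *)
Lemma exists_root_bracket (r P n : nat) : (0 < r)%N -> (0 < P)%N ->
  exists B, (r * B ^ P <= n < r * B.+1 ^ P)%N.
Proof.
move=> r_gt0 P_gt0.
have ex : exists B, (r * B ^ P <= n)%N by exists 0%N; rewrite exp0n // muln0.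
have bd B : (r * B ^ P <= n)%N -> (B <= n)%N.
  apply: leq_trans; case: B => // B; rewrite (leq_trans _ (leq_pmull _ r_gt0)) //.
  by rewrite -[X in (X <= _)%N]expn1 leq_pexp2l.
case: (ex_maxnP ex bd) => B leB maxB; exists B; rewrite leB ltnNge.
by apply/negP => /maxB; rewrite ltnn.
Qed.

(** The strict inequality of exponents leaves a spare factor [B], which absorbs the constants [c1]
    and [c2]. *)
Lemma density_arith (e P w c1 c2 B n sigma : nat) :
    (P * (2 * e - 1) < e * (P + w))%N -> (0 < c2)%N -> (0 < B)%N -> (0 < e)%N ->
    (c2 ^ e * c1 ^ (2 * e - 1) <= B)%N ->
    (n < c1 * B ^ P)%N -> (B ^ w <= c2 * sigma)%N ->
  (n ^ (2 * e - 1) < (B ^ P * sigma) ^ e)%N.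
Proof.
move=> exp_lt c2_gt0 B_gt0 e_gt0 leB ltn les.
rewrite -(ltn_pmul2l (_ : 0 < c2 ^ e)%N) ?expn_gt0 ?c2_gt0 // -expnMn mulnCA.
apply: (@leq_trans ((B ^ P * B ^ w) ^ e)); last first.
  by rewrite leq_exp2r // leq_mul2l les orbT.
apply: (@leq_trans (c2 ^ e * (c1 * B ^ P) ^ (2 * e - 1))).
  by rewrite ltn_pmul2l ?expn_gt0 ?c2_gt0 // ltn_exp2r //; lia.
rewrite expnMn mulnA (leq_trans (leq_mul leB (leqnn _))) //.
by rewrite -expnM -expnS -expnD -expnM leq_pexp2l // [((P + w) * e)%N]mulnC.
Qed.

(** The exponent condition of [density_arith] for the parameters chosen below; the two sides differ
    by [8 * e * s]. *)
Lemma exponent_arith (e s : nat) : (0 < e)%N -> (0 < s)%N ->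
  (8 * e * (s + 2 * e * s) * (2 * e - 1)
     < e * (8 * e * (s + 2 * e * s) + (8 * e - 4) * (2 * e * s)))%N.
Proof.
case: e => // e _ s_gt0.
have -> : (8 * e.+1 - 4 = 8 * e + 4)%N by lia.
have -> : (2 * e.+1 - 1 = 2 * e + 1)%N by lia.
rewrite -[X in (X < _)%N]addn0 [X in (_ < X)%N](_ : _ =
  8 * e.+1 * (s + 2 * e.+1 * s) * (2 * e + 1) + 8 * e.+1 * s)%N; last by ring.
by rewrite ltn_add2l !muln_gt0.
Qed.

(** Each of [2 * m] coefficients has order [b ^ 2], so fixing the sphere costs [b ^ (4 * m)]; hence
    the exponent [(k - 4) * m] later. *)
Lemma sphere_count_arith (k m b : nat) : (0 < k * m)%N -> (0 < b)%N ->
  ((k * (m * b * b)).+1 ^ (2 * m) <= (2 * (k * m)) ^ (2 * m) * b ^ (4 * m))%N.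
Proof.
move=> km_gt0 b_gt0; have m_gt0 : (0 < m)%N by case: (m) km_gt0; rewrite ?muln0.
have -> : (4 * m = 2 * (2 * m))%N by rewrite mulnA.
rewrite [(b ^ (2 * _))%N]expnM -expnMn leq_exp2r ?muln_gt0 //.
have -> : (2 * (k * m) * b ^ 2 = k * (m * b * b) + k * (m * b * b))%N.
  by rewrite addnn -mul2n -mulnn !mulnA.
by rewrite -addn1 leq_add2l !mulnA -mulnA !muln_gt0 -muln_gt0 km_gt0 b_gt0.
Qed.

Lemma exists_dense_rainbow_free (r e : nat) : (1 < r)%N -> (0 < e)%N ->
  exists N, forall n, (N <= n)%N ->
  exists (part : 'I_n -> 'I_r) (E : {set {set 'I_n}}),
    [/\ partite part E, (n ^ (2 * e - 1) < #|E| ^ e)%N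
      & forall K, ~ has_rainbow_cycle part E K.+2].
Proof.
move=> r_gt1 e_gt0; have [a a_orders] := exists_polys_realizing_orders r.
have r_gt0 : (0 < r)%N by apply: ltnW.
pose s := (\max_i size (a i)).+1; pose L := (\max_i l1norm (a i))%N.
(* Then [w / P] is [(1 - 4/k) * m/(s + m) = (2e - 1)/(2e + 1)], which exceeds [1 - 1/e]. *)
pose k := (8 * e)%N; pose m := (2 * e * s)%N; pose M := (s + m)%N.
pose P := (k * M)%N; pose w := ((k - 4) * m)%N.
pose C0 := (r * (2 * L)).+1.
pose c1 := (r * 2 ^ P)%N; pose c2 := ((2 * C0) ^ w * (2 * (k * m)) ^ (2 * m))%N.
(* The summands serve, in order, to absorb the constants, to make [b] positive and to make [B]
   exceed 1. *)
pose B0 := (c2 ^ e * c1 ^ (2 * e - 1) + C0 + 2)%N.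
have s_gt0 : (0 < s)%N by [].
have k_gt4 : (4 < k)%N by apply: (@leq_trans (8 * 1)); rewrite ?leq_mul2l.
have k_gt0 : (0 < k)%N by apply: leq_trans k_gt4.
have m_gt0 : (0 < m)%N by rewrite !muln_gt0 e_gt0.
have km_gt0 : (0 < k * m)%N by rewrite muln_gt0 k_gt0.
have P_gt0 : (0 < P)%N by rewrite muln_gt0 k_gt0 addn_gt0.
exists (r * B0 ^ P)%N => n le_n.
have [B /andP[leBn ltnB]] := exists_root_bracket n r_gt0 P_gt0.
have leB0B : (B0 <= B)%N.
  have := leq_ltn_trans le_n ltnB.
  by rewrite ltn_pmul2l // ltn_exp2r // ltnS.
have B_gt1 : (1 < B)%N by rewrite (leq_trans _ leB0B) // /B0 addn2.
(* Small enough to exclude wraparound, yet at least [B / (2 * C0)]. *)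
pose b := (B %/ C0)%N.
have b_gt0 : (0 < b)%N.
  rewrite divn_gt0 // (leq_trans _ leB0B) // /B0 -addnA addnCA leq_addr //.
have leB2b : (B <= 2 * C0 * b)%N.
  have := ltn_ceil B (ltn0Sn _ : 0 < C0)%N.
  rewrite -/b => /ltnW /leq_trans; apply; rewrite mulnAC leq_mul2r.
  by rewrite mul2n -addnn -addn1 leq_add2l b_gt0 orbT.
have ltLB : (r * (2 * (L * b)) < B)%N.
  apply: (@leq_trans (C0 * b)); last by rewrite mulnC leq_trunc_div.
  by rewrite mulnA mulnA -[(r * 2 * L)%N]mulnA ltn_pmul2r.
have [S [sphereS cardS]] := exists_large_sphere k m b.
have size_a i : (size (a i) + m <= M)%N.
  by rewrite leq_add2r ltnW // ltnS; apply: leq_bigmax.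
have norm_a i : (l1norm (a i) <= L)%N by apply: leq_bigmax.
pose E := edges M B a S.
have partE : partite fst E by apply: partite_edges.
have cardE : #|E| = (B ^ P * #|S|)%N by apply: (card_edges a_orders size_a norm_a).
have leTn : (#|{: 'I_r * 'M['Z_B]_(k, M)}| <= #|'I_n|)%N.
  by rewrite card_prod card_mx !card_ord Zp_cast.
have [f f_inj] : exists f : 'I_r * 'M['Z_B]_(k, M) -> 'I_n, injective f.
  rewrite card_ord in leTn; exists (fun x => widen_ord leTn (enum_rank x)) => x y [].
  by move/val_inj/enum_rank_inj.
have [part' [E' [part'E' cardE' noE']]] :=
  rainbow_free_transport (Ordinal r_gt0) f_inj partE.
exists part', E'; split=> // [|K]; last first.
  apply: noE'; exact: (edges_no_rainbow_cycle a_orders size_a norm_a ltLB sphereS).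
rewrite cardE' cardE; apply: (@density_arith e P w c1 c2) => //.
- exact: exponent_arith.
- by rewrite muln_gt0 !expn_gt0 !(muln_gt0 2) km_gt0.
- exact: ltnW.
- by rewrite (leq_trans _ leB0B) // /B0 -addnA leq_addr.
- rewrite (leq_trans ltnB) // /c1 -mulnA leq_mul2l -expnMn leq_exp2r //.
  by rewrite mul2n -addnn -addn1 leq_add2l (ltnW B_gt1) orbT.
apply: (@leq_trans ((2 * C0) ^ w * b ^ w)).
  by rewrite -expnMn leq_exp2r // muln_gt0 m_gt0 subn_gt0 k_gt4.
rewrite /c2 -mulnA leq_mul2l; apply/orP; right.
have b4m_gt0 : (0 < b ^ (4 * m))%N by rewrite expn_gt0 b_gt0.
rewrite -(leq_pmul2r b4m_gt0) -expnD /w -mulnDl subnK ?(leq_trans cardS) ?(ltnW k_gt4) //.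
rewrite mulnAC leq_mul2r; apply/orP; right.
exact: sphere_count_arith.
Qed.

(** * From each exponent [2 - 1/e] to [2 - o(1)] *)

(** Take for [g n] the largest [e <= n] with [P e n]; the cap by [n] makes the maximum exist, and
    [P 0 n] for large [n] makes it attained. *)
Lemma diagonal_index (P : nat -> nat -> Prop) :
    (forall e, exists N, forall n, (N <= n)%N -> P e n) ->
  exists g : nat -> nat, (exists N, forall n, (N <= n)%N -> P (g n) n) /\
    (forall e, exists N, forall n, (N <= n)%N -> (e <= g n)%N).
Proof.
move=> evP; exists (fun n => \max_(i < n.+1 | `[< P i n >]) i)%N; split.
  have [N PN] := evP 0%N; exists N => n leNn.
  have P0 : `[< P (@ord0 n) n >] by apply/asboolP/PN.
  rewrite (bigop.bigmax_eq_arg (P := fun i : 'I_n.+1 => `[< P i n >]) _ P0).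
  by case: arg_maxnP => // i /asboolP.
move=> e; have [N PN] := evP e; exists (maxn N e) => n.
rewrite geq_max => /andP[leNn]; rewrite -ltnS => lten.
by apply: (@leq_bigmax_cond _ _ _ (Ordinal lten)); apply/asboolP/PN.
Qed.

Lemma powR_lt_of_expn_lt (R : realType) (n c e : nat) : (0 < e)%N ->
  (n ^ (2 * e - 1) < c ^ e)%N -> (n%:R : R) `^ (2 - e%:R^-1) < c%:R.
Proof.
move=> e_gt0 ltnc; rewrite ltNge; apply/negP => lecn.
have e_neq0 : e%:R != 0 :> R by rewrite pnatr_eq0 -lt0n.
have : (c%:R : R) ^+ e <= ((n%:R : R) `^ (2 - e%:R^-1)) ^+ e.
  by apply: lerXn2r => //; rewrite nnegrE // powR_ge0.
rewrite -[X in _ <= X]powR_mulrn ?powR_ge0 // -powRrM.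
rewrite (_ : (2 - e%:R^-1) * e%:R = (2 * e - 1)%:R :> R); last first.
  by rewrite natrB ?muln_gt0 // natrM mulrBl mulVf.
by rewrite powR_mulrn // -!natrX ler_nat leqNgt ltnc.
Qed.

Local Open Scope classical_set_scope.

Theorem theorem4 (R : realType) (r : nat) (hr : (3 <= r)%N) :
  exists eps : nat -> R, eps n @[n --> \oo] --> (0 : R) /\
  exists N : nat, forall n : nat, (N <= n)%N ->
  exists (part : 'I_n -> 'I_r) (E : {set {set 'I_n}}),
    [/\ uniform r E, partite part E, linear_hypergraph E,
        (n%:R : R) `^ (2 - eps n) < (#|E|)%:R
      & ~ has_rainbow_cycle part E 3 /\ ~ has_rainbow_cycle part E 4].
Proof.
(* The shift to [e.+1] makes index 0 meaningful and gives [eps n] the form [1 / (g n + 1)]. *)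
pose P e n := exists (part : 'I_n -> 'I_r) (E : {set {set 'I_n}}),
  [/\ partite part E, (n ^ (2 * e.+1 - 1) < #|E| ^ e.+1)%N
    & forall K, ~ has_rainbow_cycle part E K.+2].
have [g [[N gN] g_ge]] : exists g : nat -> nat,
    (exists N, forall n, (N <= n)%N -> P (g n) n) /\
    (forall e, exists N, forall n, (N <= n)%N -> (e <= g n)%N).
  by apply: diagonal_index => e; apply: exists_dense_rainbow_free => //; apply: ltnW.
exists (fun n => (g n).+1%:R^-1); split.
  apply: (cvg_comp g (fun e => (e.+1%:R : R)^-1) _ cvg_harmonic).
  move=> A [e _ eA]; have [N' geN'] := g_ge e.
  by exists N' => // n /geN' ?; apply: eA.
exists N => n /gN[part [E [partE cardE noE]]]; exists part, E.
split.
- exact: partite_uniform partE.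
- exact: partE.
- exact: partite_linear partE (noE 0%N).
- exact: powR_lt_of_expn_lt.
- by split; apply: noE.
Qed.
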